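(* Consider the SQ($d$) policy with memory, exponential job sizes with mean $1/\mu$ and arrival rate $\lambda<\mu$, and put $\rho=\lambda/\mu$. Let $\pi_0\in(0,1]$ be the equilibrium probability that the memory is empty and let $u_k$ be the equilibrium probability that the queue at the cavity has $k$ or more jobs. Then for all $k\ge1$ $$u_k=\rho^{\frac{d^k-1}{d-1}}\cdot\pi_0^{\frac{d^{k-1}-1}{d-1}}=\frac{(\rho\,\pi_0^{1/d})^{\frac{d^k-1}{d-1}}}{\pi_0^{1/d}} .$$
   Context: $d\ge1$ is an integer and $\lambda>0$; for $d=1$ the fraction $\frac{d^j-1}{d-1}$ is read as $j$. Queue at the cavity for SQ($d$) with memory in equilibrium: a queue whose number of jobs $X$ evolves as a continuous-time Markov process on $\{0,1,2,\dots\}$, with $u_k=\mathbb{P}(X\ge k)$ in equilibrium ($u_0=1$, $u_k\to0$ as $k\to\infty$). - Potential arrivals occur at rate $\lambda d\pi_0$. At a potential arrival, $d-1$ i.i.d. queue lengths with the equilibrium law of $X$ are drawn, independent of $X$; the job joins the queue at the cavity iff its queue length is the smallest of the $d$ values, ties being broken uniformly at random. Thus in state $k$ these arrivals join at rate $\lambda\pi_0\,(u_k^d-u_{k+1}^d)/(u_k-u_{k+1})$ (when $u_k>u_{k+1}$). - When the queue is empty there is an additional arrival rate $\lambda(1-\pi_0)/(1-u_1)$ (jobs routed to an idle server whose id is in memory). - When nonempty, departures occur at rate $\mu$. The equilibrium law is a probability law that is stationary for this process, with the rates computed from that same law. *)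

(* Defs.v *)
From mathcomp Require Import all_boot all_order all_algebra.
From mathcomp Require Import all_classical all_reals all_analysis.
Set Implicit Arguments.
Unset Strict Implicit.
Unset Printing Implicit Defensive.
Import Order.TTheory GRing.Theory Num.Theory.
Import numFieldNormedType.Exports.
Local Open Scope classical_set_scope.
Local Open Scope ring_scope.

(** Continuous-time Markov chains on [nat]; [P t i] is the law at time [t] of
    the chain started at [i].  Only the times [0 <= t] are meaningful. *)

Definition transition_function (R : realType) (P : R -> nat -> probability nat R)
    : Prop :=
  (forall (i : nat) (A : set nat), P 0 i A = \d_i A) /\
  (forall (s t : R) (i : nat) (A : set nat), 0 <= s -> 0 <= t ->
     P (s + t) i A = (\int[P s i]_j P t j A)%E).

(** The transition rates are the right derivatives at time 0. *)
Definition has_rates (R : realType) (P : R -> nat -> probability nat R)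
    (Q : nat -> nat -> R) : Prop :=
  forall i j : nat,
    (fun h : R => (fine (P h i [set j]) - (i == j)%:R) / h) @ 0^'+ --> Q i j.

Definition stationary (R : realType) (P : R -> nat -> probability nat R)
    (law : probability nat R) : Prop :=
  forall (t : R) (A : set nat), 0 <= t -> (\int[law]_i P t i A)%E = law A.

Definition tail (R : realType) (law : probability nat R) (k : nat) : R :=
  fine (law [set n | (k <= n)%N]).

(** Conditional probability of joining: the expectation, over the [d - 1]
    i.i.d. draws [t], of [1 / (1 + #ties)] on the event that no draw is smaller
    than [k] (uniform tie-breaking among all the minimal queues). *)
Definition join_probability (R : realType) (d : nat) (law : probability nat R)
    (k : nat) : R :=
  fine (\esum_(t in [set: (d.-1).-tuple nat])
    ((\prod_(q <- t) fine (law [set q])) *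
     (if all (fun q => (k <= q)%N) t
      then (1 + count_mem k t)%:R^-1 else 0))%:E).

(** If [tail law 1 = 1] the last quotient is [0] by convention; this is harmless,
    as the empty state then has probability 0, which no stationary law of the
    resulting chain allows. *)
Definition arrival_rate (R : realType) (d : nat) (lambda pi0 : R)
    (law : probability nat R) (k : nat) : R :=
  lambda * d%:R * pi0 * join_probability d law k +
  (if k == 0%N then lambda * (1 - pi0) / (1 - tail law 1) else 0).

Definition cavity_rates (R : realType) (d : nat) (lambda mu pi0 : R)
    (law : probability nat R) (i j : nat) : R :=
  let a := arrival_rate d lambda pi0 law i in
  let b := if (0 < i)%N then mu else 0 in
  if j == i.+1 then a
  else if i == j.+1 then b
  else if i == j then - (a + b)
  else 0.

(** The rates are computed from the same law that is required to be
    stationary. *)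
Definition equilibrium_law (R : realType) (d : nat) (lambda mu pi0 : R)
    (law : probability nat R) : Prop :=
  exists P : R -> nat -> probability nat R,
    [/\ transition_function P,
        has_rates P (cavity_rates d lambda mu pi0 law)
      & stationary P law].

(** [(d ^ j - 1) / (d - 1)], read as [j] for [d = 1]; the division is exact. *)
Definition geom_exponent (d j : nat) : nat :=
  if d == 1%N then j else ((d ^ j - 1) %/ (d - 1))%N.

(* Main.v *)
(** The total rate out of a state is bounded by some constant [C], and
    supermultiplicativity of [t |-> P_t(i, i)] gives [1 - P_t(i, i) <= C t] for
    all [i] and [t].  Hence the difference quotients
    [(P_t(i, j) - delta_ij) / t] are uniformly bounded, and dominated
    convergence turns stationarity into the global balance equations.  Summed
    over [j <= k] they say that the flows across the cut between [k] and [k + 1]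
    agree.  A binomial computation shows that the upward flow is
    [lambda pi0 (u_k^d - u_(k+1)^d)], plus [lambda (1 - pi0)] if [k = 0], while
    the downward flow is [mu (u_(k+1) - u_(k+2))].  Telescoping with [u_k --> 0]
    yields [mu u_1 = lambda] and [mu u_(k+2) = lambda pi0 u_(k+1)^d]. *)

Require Import Defs.
From mathcomp Require Import all_boot all_order all_algebra.
From mathcomp Require Import all_classical all_reals all_analysis.
From mathcomp Require Import ring lra.
Import Order.TTheory GRing.Theory Num.Theory.
Import numFieldNormedType.Exports.
Local Open Scope ring_scope.

(** * Tails, point masses and integrals for a law on the naturals *)

Section probability_on_nat.
Context (R : realType).
Implicit Types (law : probability nat R) (A B : set nat).

Lemma fine_probE law A : law A = (fine (law A))%:E.
Proof. by rewrite fineK// fin_num_measure. Qed.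

Lemma fine_prob_ge0 law A : 0 <= fine (law A).
Proof. exact/fine_ge0/measure_ge0. Qed.

Lemma fine_prob_le1 law A : fine (law A) <= 1.
Proof. by rewrite -lee_fin -fine_probE probability_le1. Qed.

Lemma fine_prob_leD law i j : i != j ->
  fine (law [set i]%classic) + fine (law [set j]%classic) <= 1.
Proof.
move=> ij; rewrite -lee_fin EFinD -!fine_probE.
rewrite -measureU ?probability_le1//.
by apply/seteqP; split=> // x [/= -> ji]; rewrite ji eqxx in ij.
Qed.

Lemma fine_prob_set1 law k :
  fine (law [set k]%classic) = tail law k - tail law k.+1.
Proof.
suff <- : fine (law [set k]%classic) + tail law k.+1 = tail law k by ring.
apply: EFin_inj; rewrite EFinD /tail -!fine_probE -measureU//.
  congr (law _); apply/seteqP; split=> x /=; first by case=> [->//|/ltnW].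
  by rewrite leq_eqVlt => /orP[/eqP->|]; [left|right].
by apply/seteqP; split=> // x [/= ->]; rewrite ltnn.
Qed.

Lemma tail0 law : tail law 0 = 1.
Proof.
rewrite /tail (_ : [set n | (0 <= n)%N]%classic = setT) ?probability_setT//.
exact/seteqP.
Qed.

(** Continuity from above: the tail sets decrease to the empty set. *)
Lemma cvg_tail law : (tail law k @[k --> \oo] --> 0)%classic.
Proof.
have : (law [set n | (k <= n)%N] @[k --> \oo] --> law set0)%classic.
  have cap0 : (\bigcap_k [set n | (k <= n)%N] = set0)%classic.
    by apply/seteqP; split=> // n /(_ n.+1 I) /=; rewrite ltnn.
  rewrite -cap0.
  apply: (@nonincreasing_cvg_mu _ _ _ law (fun k => [set n | (k <= n)%N]%classic)) => //.
    by rewrite -ge0_fin_numE ?fin_num_measure.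
  by move=> m n mn; apply/subsetPset => x /=; exact: leq_trans.
by rewrite measure0 => /fine_cvgP[].
Qed.

Lemma integrable_bounded law (f : nat -> R) (C : R) :
  (forall n, `|f n| <= C) -> law.-integrable setT (EFin \o f).
Proof.
move=> fC; apply: (@le_integrable _ _ _ _ _ _ _ (EFin \o cst C)) => //.
  by move=> n _ /=; rewrite lee_fin (le_trans (fC n))// ler_norm.
exact: finite_measure_integrable_cst.
Qed.

(** Links the integrals of the Chapman-Kolmogorov equation with the extended sums that define
    [join_probability]. *)
Lemma ge0_integral_nat law (f : nat -> R) : (forall n, 0 <= f n) ->
  (\int[law]_n (f n)%:E = \esum_(n in setT) (fine (law [set n]%classic) * f n)%:E)%E.
Proof.
move=> f0.
have cupT : (\bigcup_n [set n] = [set: nat])%classic.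
  by apply/seteqP; split=> // n _; exists n.
rewrite -[in LHS]cupT ge0_integral_bigcup//; first last.
- by move=> i j _ _ [x [/= -> ->]].
- by move=> x _; rewrite lee_fin.
rewrite -nneseries_esumT; last by move=> n; rewrite lee_fin mulr_ge0// fine_prob_ge0.
apply: eq_eseriesr => n _.
rewrite (@eq_integral _ _ _ law _ (cst (f n)%:E))//.
  by rewrite integral_cst// mulrC EFinM -fine_probE.
by move=> x; rewrite inE /= => ->.
Qed.

End probability_on_nat.

(** * Expectations over i.i.d. draws *)

Section sampling.
Context (R : realType) (law : probability nat R) (k : nat).
Local Notation p := (fine (law [set k]%classic)).
Local Notation u := (tail law k.+1).
Local Notation weight s := ((\prod_(q <- s) fine (law [set q]%classic)) *
  (all (fun q => (k <= q)%N) s)%:R).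

Let weight_ge0 (s : seq nat) : 0 <= weight s :> R.
Proof.
by rewrite mulr_ge0 ?ler0n//; apply: prodr_ge0 => q _; exact: fine_prob_ge0.
Qed.

Lemma esum_tupleS n (a : n.+1.-tuple nat -> \bar R) : (forall t, 0 <= a t)%E ->
  (\esum_(t in [set: n.+1.-tuple nat]) a t =
   \esum_(t in [set: n.-tuple nat]) \esum_(q in [set: nat]) a (cons_tuple q t))%E.
Proof.
move=> a0; rewrite esum_esum//.
apply: (reindex_esum _ _ (fun x : n.-tuple nat * nat => cons_tuple x.2 x.1)).
split=> //.
  move=> [t q] [t' q'] _ _ /(congr1 val)/= [-> tt'].
  by congr pair; exact: val_inj.
move=> t _; exists (behead_tuple t, thead t) => //.
by rewrite [RHS]tuple_eta; exact: val_inj.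
Qed.

(** A draw ties with [k] with probability [p], exceeds [k] with probability [u], and otherwise
    contributes nothing. *)
Lemma esum_first_draw (g0 g1 : R) : 0 <= g0 -> 0 <= g1 ->
  (\esum_(q in setT) (fine (law [set q]%classic) *
     (if q == k then g1 else if (k < q)%N then g0 else 0))%:E = (p * g1 + u * g0)%:E)%E.
Proof.
move=> g00 g10; rewrite -ge0_integral_nat; last by move=> q; case: ifP => // _; case: ifP.
rewrite (eq_integral (fun q => g1%:E * (\1_[set k] q)%:E +
    g0%:E * (\1_[set n | (k < n)%N] q)%:E)%E); last first.
  move=> q _; rewrite -!EFinM -EFinD; congr EFin; rewrite !indicE.
  case: eqVneq => [->|qk].
    by rewrite mem_set// memNset ?mulr1 ?mulr0 ?addr0//= ltnn.
  rewrite memNset; last exact/eqP.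
  case: ifPn => kq; first by rewrite mem_set// mulr0 mulr1 add0r.
  by rewrite memNset ?mulr0 ?addr0//=; exact/negP.
rewrite ge0_integralD//; first last.
- by move=> x _; rewrite mule_ge0// lee_fin.
- by move=> x _; rewrite mule_ge0// lee_fin.
rewrite !ge0_integralZl ?lee_fin//.
rewrite !integral_indic// !setIT EFinD !EFinM /tail -!fine_probE.
by rewrite muleC [X in (_ + X)%E]muleC.
Qed.

(* Averaging over the first draw turns [g] into [g'] below and leaves [n] draws,
   which is Pascal's rule on the binomial side; hence the arbitrary [g]. *)
Lemma esum_draws n (g : nat -> R) : (forall m, 0 <= g m) ->
  (\esum_(t in [set: n.-tuple nat]) (weight t * g (count_mem k t))%:E =
   (\sum_(m < n.+1) (p ^+ m * u ^+ (n - m) * g m) *+ 'C(n, m))%:E)%E.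
Proof.
elim: n g => [|n IHn] g g0.
  rewrite (_ : setT = [set [tuple]]%classic); last first.
    by apply/seteqP; split=> // t _ /=; rewrite tuple0.
  rewrite esum_set1; last by rewrite lee_fin; exact: mulr_ge0.
  by rewrite big_nil/= big_ord1/= !expr0 !mul1r bin0.
rewrite (@esum_tupleS n (fun t => (weight t * g (count_mem k t))%:E)); last first.
  by move=> t; rewrite lee_fin; exact: mulr_ge0.
pose g' m := p * g m.+1 + u * g m.
have g'0 m : 0 <= g' m by rewrite addr_ge0// mulr_ge0// fine_prob_ge0.
transitivity (\esum_(t in [set: n.-tuple nat]) (weight t * g' (count_mem k t))%:E)%E.
  apply: eq_esum => t _.
  pose w : R := weight t; pose c := count_mem k t.
  transitivity (\esum_(q in setT) (fine (law [set q]%classic) *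
     (if q == k then w * g c.+1 else if (k < q)%N then w * g c else 0))%:E)%E.
    apply: eq_esum => q _; congr EFin.
    rewrite big_cons /= -/c (eq_sym q) leq_eqVlt.
    case: eqVneq => [<-|qk]/=.
      by rewrite add1n -!mulrA.
    case: ifP => kq/=; rewrite ?add0n -?mulrA//.
    by rewrite mulr0n mul0r !mulr0.
  rewrite esum_first_draw; [|exact: (mulr_ge0 (weight_ge0 t) (g0 _))..].
  by rewrite /g'; congr EFin; rewrite -/w -/c; ring.
rewrite IHn//; congr EFin.
rewrite [RHS](eq_bigr (fun m : 'I_n.+2 => p ^+ m * u ^+ (n.+1 - m) * g m *+ 'C(n, m) +
  (if m == 0 :> nat then 0 else p ^+ m * u ^+ (n.+1 - m) * g m *+ 'C(n, m.-1)))); last first.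
  case=> [[|m] mn] _ /=; first by rewrite !bin0 addr0.
  by rewrite binS mulrnDr.
rewrite big_split/=.
(* The last term of the first sum has the factor ['C(n, n.+1) = 0] and the first term of the second
   is [0], so both reduce to [n.+1] terms, the second shifted by one. *)
rewrite [X in _ = X + _]big_ord_recr/= bin_small// mulr0n addr0.
rewrite [X in _ = _ + X]big_ord_recl/= add0r -big_split/=.
apply: eq_bigr => m _; have mn : (m <= n)%N by rewrite -ltnS.
rewrite -mulrnDl subSS subSn// /bump leq0n add1n !exprS /g'; congr (_ *+ _).
ring.
Qed.

End sampling.

(** * The joining probability as a binomial sum *)

Section join.
Context (R : realType) (law : probability nat R) (d k : nat).
Hypothesis d_gt0 : (0 < d)%N.
Local Notation p := (fine (law [set k]%classic)).
Local Notation u := (tail law k.+1).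

Let tailE : u + p = tail law k.
Proof. by rewrite fine_prob_set1; ring. Qed.

Lemma join_probabilityE : join_probability d law k =
  \sum_(m < d) (p ^+ m * u ^+ (d.-1 - m) / m.+1%:R) *+ 'C(d.-1, m).
Proof.
rewrite /join_probability.
rewrite [X in fine X](_ : _ = (\esum_(t in [set: d.-1.-tuple nat])
  ((\prod_(q <- t) fine (law [set q]%classic)) * (all (fun q => (k <= q)%N) t)%:R *
   (count_mem k t).+1%:R^-1)%:E)%E); last first.
  by apply: eq_esum => t _; rewrite -mulrA; case: ifP; rewrite ?mul1r ?mul0r.
rewrite (esum_draws _ _ _ _ (fun m => m.+1%:R^-1))/=; last by move=> m; rewrite invr_ge0.
by rewrite prednK.
Qed.

Lemma join_probability_ge0 : 0 <= join_probability d law k.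
Proof.
rewrite join_probabilityE; apply: sumr_ge0 => m _.
by rewrite mulrn_wge0// divr_ge0// mulr_ge0// exprn_ge0// fine_prob_ge0.
Qed.

(** Without the factors [1 / (m + 1)] the sum is the binomial expansion of [(u + p) ^+ d.-1], a
    power of a tail. *)
Lemma join_probability_le1 : join_probability d law k <= 1.
Proof.
apply: (@le_trans _ _ ((u + p) ^+ d.-1)); last first.
  by rewrite tailE exprn_ile1 ?fine_prob_ge0 ?fine_prob_le1.
rewrite join_probabilityE exprDn prednK//; apply: ler_sum => m _.
rewrite ler_wMn2r// [leRHS]mulrC ler_pdivrMr// ler_peMr ?ler1n//.
by rewrite mulr_ge0// exprn_ge0// fine_prob_ge0.
Qed.

(** Since [d * 'C(d - 1, m) = (m + 1) * 'C(d, m + 1)], the left side is the expansion of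
    [(u + p) ^+ d] without its term [u ^+ d]. *)
Lemma mul_join_probability : d%:R * p * join_probability d law k =
  tail law k ^+ d - tail law k.+1 ^+ d.
Proof.
rewrite join_probabilityE -tailE; case: d d_gt0 => // n _ /=.
rewrite exprDn [X in _ = X - _]big_ord_recl/= bin0 subn0 mulr1n expr0 mulr1.
rewrite [X in X - _]addrC addrK.
rewrite mulr_sumr; apply: eq_bigr => m _; rewrite /bump leq0n add1n subSS.
have binE : n.+1%:R * 'C(n, m)%:R = m.+1%:R * 'C(n.+1, m.+1)%:R :> R.
  by rewrite -!natrM mul_bin_diag.
rewrite -[in LHS]mulr_natr -[RHS]mulr_natr exprS.
transitivity (n.+1%:R * 'C(n, m)%:R * (p * p ^+ m * u ^+ (n - m)) / m.+1%:R); first by ring.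
rewrite binE; have : m.+1%:R != 0 :> R by rewrite pnatr_eq0.
by move: (m.+1%:R : R) => c c0; field.
Qed.

End join.

(** * From transition rates to global balance *)

Lemma bernoulli_inequality (R : realDomainType) (x : R) n :
  0 <= x -> 1 - n%:R * (1 - x) <= x ^+ n.
Proof.
move=> x0; elim: n => [|n IHn]; first by rewrite mul0r subr0 expr0.
rewrite exprS; apply: le_trans (ler_wpM2l x0 IHn).
rewrite -subr_ge0 -natr1 [leRHS](_ : _ = n%:R * (1 - x) ^+ 2); last by ring.
by rewrite mulr_ge0// exprn_even_ge0.
Qed.

Section markov_chain.
Context (R : realType) (P : R -> nat -> probability nat R) (Q : nat -> nat -> R).
Hypotheses (PT : transition_function P) (PQ : has_rates P Q).
Local Notation p t i j := (fine (P t i [set j]%classic)).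

Lemma return_probability0 i : p 0 i i = 1.
Proof. by rewrite PT.1 diracE mem_set. Qed.

(** Keep only the term of the Chapman-Kolmogorov sum in which the chain is at [i] at time [s]. *)
Lemma return_probability_mul s t i : 0 <= s -> 0 <= t ->
  p s i i * p t i i <= p (s + t) i i.
Proof.
move=> s0 t0; rewrite -lee_fin -fine_probE PT.2//.
under eq_integral do rewrite fine_probE.
rewrite ge0_integral_nat; last by move=> n; exact: fine_prob_ge0.
apply: esum_ge; exists [set i]%classic; last by rewrite fsbig_set1.
by split.
Qed.

Lemma return_probability_exp t i n : 0 <= t -> p t i i ^+ n <= p (n%:R * t) i i.
Proof.
move=> t0; elim: n => [|n IHn]; first by rewrite mul0r return_probability0 expr0.
rewrite exprS -nat1r mulrDl mul1r.
apply: le_trans (return_probability_mul _ _ _ _ _) => //; last by rewrite mulr_ge0.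
by rewrite ler_wpM2l// fine_prob_ge0.
Qed.

Lemma difference_quotient_cvg i j (t : R) : 0 < t ->
  ((p (t / n.+1%:R) i j - (i == j)%:R) / (t / n.+1%:R) @[n --> \oo] --> Q i j)%classic.
Proof.
move=> t0; have /cvg_at_rightP := @PQ i j; apply; split.
  by move=> n; rewrite divr_gt0.
rewrite -[X in (_ --> X)%classic](mulr0 t); apply: cvgZr; exact: cvg_harmonic.
Qed.

(* [P_t(i, i) >= P_(t/n)(i, i)^n >= 1 - n (1 - P_(t/n)(i, i))], and the right-hand
   side tends to [1 + Q i i * t]. *)
Lemma return_probability_lower t i : 0 <= t -> 1 - p t i i <= - Q i i * t.
Proof.
rewrite le_eqVlt => /predU1P[<-|t0]; first by rewrite return_probability0 subrr mulr0.
rewrite -ler_pdivrMr// lerNr -mulNr opprB.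
apply: cvgr_to_le (difference_quotient_cvg i i t t0) _.
apply: nearW => n; rewrite eqxx mulr1n.
have n0 : n.+1%:R != 0 :> R by rewrite pnatr_eq0.
have := return_probability_exp (t / n.+1%:R) i n.+1 (divr_ge0 (ltW t0) (ler0n _ _)).
have := bernoulli_inequality _ (p (t / n.+1%:R) i i) n.+1 (fine_prob_ge0 _ _ _).
move: (n.+1%:R : R) n0 (p _ _ _ ^+ _) => c c0 y; rewrite [c * (t / c)]mulrC divfK//.
move: (p (t / c) i i) => x xy yt.
rewrite invf_div mulrA ler_pM2r ?invr_gt0//; lra.
Qed.

(** The diagonal increment dominates its row: for [j] other than [i], [p t i j] is at most
    [1 - p t i i]. *)
Lemma transition_increment_le t i j : 0 <= t ->
  `|p t i j - (i == j)%:R| <= - Q i i * t.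
Proof.
move=> t0; apply: le_trans (return_probability_lower t i t0).
case: eqVneq => [<-|ij]; first by rewrite distrC ger0_norm// subr_ge0 fine_prob_le1.
by rewrite subr0 ger0_norm ?fine_prob_ge0// lerBrDl fine_prob_leD.
Qed.

Lemma global_balance law C : stationary P law -> (forall i, - Q i i <= C) ->
  forall j, law.-integrable setT (fun i => (Q i j)%:E) /\
    (\int[law]_i (Q i j)%:E = 0)%E.
Proof.
move=> Plaw QC j.
(* A sequence of times tending to 0, as dominated convergence is applied to sequences. *)
pose h n : R := 1 / n.+1%:R.
have h0 n : 0 < h n by rewrite divr_gt0.
have hP n i : (fun i => (p (h n) i j)%:E) i = P (h n) i [set j]%classic.
  by rewrite -fine_probE.
pose f n i := (p (h n) i j - (i == j)%:R) / h n.
have fle n i : `|f n i| <= C.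
  rewrite normrM normfV (gtr0_norm (h0 n)) ler_pdivrMr//.
  apply: le_trans (transition_increment_le _ _ _ (ltW (h0 n))) _.
  by rewrite ler_wpM2r// ltW.
(* By stationarity [p (h n) i j] and the indicator of [j] both integrate to the mass of [j]. *)
have intf n : (\int[law]_i (f n i)%:E = 0)%E.
  rewrite (eq_integral (fun i => (h n)^-1%:E *
    ((p (h n) i j)%:E - (\1_[set j]%classic i)%:E))%E); last first.
    move=> i _; rewrite -EFinB -EFinM mulrC indicE /f.
    by case: eqVneq => [->|/eqP ij]; [rewrite mem_set|rewrite memNset].
  have ip : law.-integrable setT (fun i => (p (h n) i j)%:E).
    apply: (@integrable_bounded _ _ _ 1) => i.
    by rewrite ger0_norm ?fine_prob_ge0 ?fine_prob_le1.
  have i1 : law.-integrable setT (fun i => (\1_[set j]%classic i)%:E : \bar R).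
    by apply: (@integrable_bounded _ _ _ 1) => i; rewrite indicE normr_nat lern1 leq_b1.
  rewrite integralZl//; last exact: integrableB.
  rewrite integralB// integral_indic// setIT.
  under eq_integral => i _ do rewrite (hP n i).
  by rewrite Plaw ?ltW// subee ?mule0// fin_num_measure.
have cvgf i : (f n i @[n --> \oo] --> Q i j)%classic.
  by apply: difference_quotient_cvg.
have [] := @dominated_convergence _ _ _ law setT measurableT
  (fun n i => (f n i)%:E) (fun i => (Q i j)%:E) (cst C%:E) => //.
- by apply/aeW => i _; apply: cvg_EFin; [exact: nearW|exact: cvgf].
- exact: finite_measure_integrable_cst.
- by apply/aeW => i n _; rewrite abse_EFin lee_fin fle.
move=> iQ _; under eq_fun do rewrite intf.
by move=> /(cvg_unique _ (cvg_cst _)) <-.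
Qed.


End markov_chain.

(** * The exponent as a geometric sum *)

Lemma geom_exponentE d k : (0 < d)%N -> geom_exponent d k = (\sum_(i < k) d ^ i)%N.
Proof.
rewrite /geom_exponent; case: d => [|[|d]]// _.
  by under eq_bigr do rewrite exp1n; rewrite sum_nat_const card_ord muln1.
by rewrite /= !subn1 predn_exp mulKn.
Qed.

Lemma geom_exponentS d k : (0 < d)%N ->
  geom_exponent d k.+1 = (d * geom_exponent d k).+1.
Proof.
move=> d0; rewrite !geom_exponentE// big_ord_recl expn0 big_distrr/= add1n.
by congr S; apply: eq_bigr => i _; rewrite expnS.
Qed.

(** * Cut equations and tails of the queue at the cavity *)

Section cavity.
Context (R : realType) (d : nat) (lambda mu pi0 : R) (law : probability nat R).
Hypotheses (d_gt0 : (0 < d)%N) (lambda_gt0 : 0 < lambda) (mu_gt0 : 0 < mu).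
Hypotheses (pi0_gt0 : 0 < pi0).
Hypothesis equi : equilibrium_law d lambda mu pi0 law.
Local Notation a := (arrival_rate d lambda pi0 law).
Local Notation Q := (cavity_rates d lambda mu pi0 law).
Local Notation p k := (fine (law [set k]%classic)).
Local Notation u := (tail law).

(** The net rate into the states up to [k]: jumps inside or outside this set cancel, leaving only
    those across the cut. *)
Lemma sum_cavity_rates i k :
  \sum_(j < k.+1) Q i j = mu * (i == k.+1)%:R - a k * (i == k)%:R.
Proof.
elim: k => [|k IHk].
  rewrite big_ord1/= /cavity_rates/=.
  by case: i => [|[|i]]//=; rewrite ?mulr0 ?mulr1 ?subr0 ?sub0r ?addr0.
rewrite big_ord_recr/= IHk /cavity_rates.
rewrite eqSS (eq_sym k i).
case: (eqVneq i k) => [->|ik].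
  by rewrite !ltn_eqF//=; ring.
case: (eqVneq i k.+1) => [->|ik1]; first by rewrite !ltn_eqF//=; ring.
case: (eqVneq i k.+2) => [->|ik2]/=; ring.
Qed.

Lemma cavity_rates_bounded : exists C, forall i, - Q i i <= C.
Proof.
(* The absolute value makes one bound serve both state 0, which has the extra arrivals, and the
   other states. *)
exists (lambda * d%:R * pi0 + `|lambda * (1 - pi0) / (1 - u 1)| + mu) => i.
rewrite /cavity_rates eqxx ltn_eqF// opprK.
rewrite lerD//; last by case: ifP => // _; exact: ltW.
rewrite lerD//; last by case: ifP => _; rewrite ?ler_norm.
rewrite ler_piMr ?join_probability_le1//.
by rewrite !mulr_ge0// ltW.
Qed.

Lemma cut_balance k : mu * p k.+1 = a k * p k.
Proof.
have [P [PT PQ Plaw]] := equi.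
have [C QC] := cavity_rates_bounded.
have bal := global_balance _ _ _ PT PQ _ _ Plaw QC.
have : (\int[law]_i (\sum_(j < k.+1) (Q i j)%:E) = 0)%E.
  rewrite integral_sum//; last by move=> j; have [] := bal j.
  by rewrite big1// => j _; have [] := bal j.
rewrite (eq_integral (fun i => mu%:E * (\1_[set k.+1]%classic i)%:E -
    (a k)%:E * (\1_[set k]%classic i)%:E)%E); last first.
  move=> i _; rewrite sumEFin sum_cavity_rates EFinB 2!EFinM !indicE.
  have in1 n : (i \in [set n]%classic) = (i == n).
    by case: eqVneq => [->|/eqP ij]; [rewrite mem_set|rewrite memNset].
  by rewrite !in1.
have int1 n : law.-integrable setT (fun i => (\1_[set n]%classic i)%:E : \bar R).
  by apply: (@integrable_bounded _ _ _ 1) => i; rewrite indicE normr_nat lern1 leq_b1.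
rewrite integralB//; [|exact: integrableZl..].
rewrite !integralZl// !integral_indic// !setIT.
move=> bal0; apply/eqP; rewrite -subr_eq0; apply/eqP/EFin_inj.
by rewrite EFinB !EFinM -!fine_probE.
Qed.

(** If [u 1 = 1], state 0 has no mass, the cut equations pass this on to every state, and the tails
    cannot tend to 0. The quotient in [arrival_rate] is thus a genuine one. *)
Lemma tail1_lt1 : u 1 < 1.
Proof.
rewrite lt_neqAle fine_prob_le1 andbT; apply/eqP => u1.
have pk0 k : p k = 0.
  elim: k => [|k IHk]; first by rewrite fine_prob_set1 tail0 u1 subrr.
  by apply: (mulfI (lt0r_neq0 mu_gt0)); rewrite cut_balance IHk !mulr0.
have uk1 k : u k = 1.
  elim: k => [|k <-]; first exact: tail0.
  by apply/esym/eqP; rewrite -subr_eq0 -fine_prob_set1 pk0.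
have := cvg_tail _ law; rewrite (_ : tail law = cst 1); last exact/funext.
move=> /(cvg_unique (@Rhausdorff R) (cvg_cst _))/eqP.
by rewrite oner_eq0.
Qed.

Lemma arrival_flow k : a k * p k =
  lambda * pi0 * (u k ^+ d - u k.+1 ^+ d) + (if k == 0%N then lambda * (1 - pi0) else 0).
Proof.
rewrite -mul_join_probability// /arrival_rate mulrDl.
case: k => [|k]; last by rewrite /= mul0r; ring.
rewrite fine_prob_set1 tail0 /= divfK; first by ring.
by rewrite subr_eq0 gt_eqF// tail1_lt1.
Qed.

Lemma tail_recurrence k : mu * u k.+2 = lambda * pi0 * u k.+1 ^+ d.
Proof.
(* The cut equation at [n.+1], where the memory term is absent, says that [D] is constant; its limit
   is 0. *)
pose D k := mu * u k.+2 - lambda * pi0 * u k.+1 ^+ d.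
have DS n : D n.+1 = D n.
  have := cut_balance n.+1; rewrite arrival_flow/= fine_prob_set1 /D => e.
  by apply/eqP; rewrite -subr_eq0; apply/eqP; lra.
have Dk n : D n = D k by elim: n => [|n]; [elim: (k) => // m ->; rewrite DS|rewrite DS].
have cvgS : (u n.+1 @[n --> \oo] --> (0 : R))%classic by rewrite cvg_shiftS; exact: cvg_tail.
have cvgSS : (u n.+2 @[n --> \oo] --> (0 : R))%classic.
  by rewrite (cvg_shiftS (fun n => u n.+1)).
have : (D n @[n --> \oo] --> mu * 0 - lambda * pi0 * 0 ^+ d)%classic.
  apply: cvgB; first exact: cvgMl_tmp.
  apply: cvgMl_tmp; exact: (continuous_cvg _ (@exprn_continuous R d 0) cvgS).
rewrite expr0n gtn_eqF// !mulr0 subrr (_ : D = cst (D k)); last exact/funext.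
by move=> /(cvg_unique (@Rhausdorff R) (cvg_cst _))/eqP; rewrite subr_eq0 => /eqP.
Qed.

(** In the cut equation at 0, [mu * u 2] cancels [lambda * pi0 * u 1 ^+ d], leaving
    [lambda * pi0 + lambda * (1 - pi0)]. *)
Lemma mul_tail1 : mu * u 1 = lambda.
Proof.
have := cut_balance 0; rewrite arrival_flow/= fine_prob_set1 mulrBr.
rewrite tail_recurrence tail0 expr1n.
by move=> /eqP; rewrite subr_eq => /eqP ->; ring.
Qed.

(** Raising to the power [d] and multiplying by [rho * pi0] sends each exponent [e] to [d * e + 1],
    the recurrence of [geom_exponent]. *)
Lemma tail_closed_form k :
  u k.+1 = (lambda / mu) ^+ geom_exponent d k.+1 * pi0 ^+ geom_exponent d k.
Proof.
have mu0 := lt0r_neq0 mu_gt0.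
elim: k => [|k IHk].
  rewrite geom_exponentS// geom_exponentE// big_ord0 muln0 expr1 expr0 mulr1.
  by rewrite -mul_tail1 mulrC mulKf.
apply: (mulfI mu0); rewrite tail_recurrence IHk (geom_exponentS d k.+1)//.
rewrite [in X in _ = _ * (_ * X)]geom_exponentS// exprMn -!exprM 2![(_ * d)%N]mulnC !exprS.
by field.
Qed.

End cavity.

Theorem theorem1 (R : realType) (d : nat) (lambda mu rho pi0 : R)
    (law : probability nat R)
    (hd : (1 <= d)%N) (hlambda : 0 < lambda) (hmu : lambda < mu)
    (hrho : rho = lambda / mu) (hpi0 : 0 < pi0) (hpi1 : pi0 <= 1)
    (hlaw : equilibrium_law d lambda mu pi0 law) :
  forall k : nat, (1 <= k)%N ->
    tail law k = rho ^+ geom_exponent d k * pi0 ^+ geom_exponent d (k - 1) /\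
    tail law k = (rho * pi0 `^ d%:R^-1) ^+ geom_exponent d k / pi0 `^ d%:R^-1.
Proof.
have mu_gt0 : 0 < mu := lt_trans hlambda hmu.
case=> [//|k _]; rewrite subn1/=.
have tailE := tail_closed_form _ _ _ _ _ _ hd hlambda mu_gt0 hpi0 hlaw k.
rewrite tailE -hrho; split=> //.
set s := pi0 `^ d%:R^-1.
have sd : s ^+ d = pi0.
  by rewrite -powR_mulrn ?powR_ge0// -powRrM mulVf ?powRr1 ?ltW// pnatr_eq0 -lt0n.
have s0 : s != 0 by rewrite lt0r_neq0// powR_gt0.
(* With [e = geom_exponent d k], the power of [s] is [s ^+ (d * e + 1) / s = pi0 ^+ e]. *)
by rewrite exprMn geom_exponentS// [s ^+ _.+1]exprS exprM sd; field.
Qed.
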